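(* Let $n\geqslant 2$ be an integer. Define the operator $\Omega:\mathcal{L}\rightarrow\mathcal{L}$ by $$\Omega F(x)=nx^{n-1}-(n-1)x^n-nx^{n-1}\int_0^{1-x}F(z)\,dz,\qquad 0\leqslant x\leqslant 1,\quad F\in\mathcal{L}.$$ Then $\Omega$ is a contraction mapping on $\mathcal{L}$ with contraction constant $\left(\frac{n-1}{n}\right)^{n-1}$; that is, $\left(\frac{n-1}{n}\right)^{n-1}<1$ and $\|\Omega F_1-\Omega F_2\|\leqslant \left(\frac{n-1}{n}\right)^{n-1}\|F_1-F_2\|$ for all $F_1,F_2\in\mathcal{L}$.
   Context: $\mathcal{L}=\mathcal{L}^\infty([0,1])$ denotes the space of all measurable and bounded (real-valued) functions on $[0,1]$, endowed with the sup norm $\|F\|=\sup_{x\in[0,1]}|F(x)|$. *)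

(* Defs.v *)
From HB Require Import structures.
From mathcomp Require Import all_boot all_order all_algebra.
From mathcomp Require Import all_classical all_reals all_analysis.

Set Implicit Arguments.
Unset Strict Implicit.
Unset Printing Implicit Defensive.

Import Order.TTheory GRing.Theory Num.Theory.
Import numFieldNormedType.Exports.

Local Open Scope classical_set_scope.
Local Open Scope ring_scope.

(** The real line with the Lebesgue sigma-algebra, i.e., the sigma-algebra on
    which [completed_lebesgue_measure] is defined; [R] itself canonically
    carries the Borel one. *)
Definition lebesgueR (R : realType) : measurableType _ :=
  caratheodory_type ((wlength (@idfun R))^*)%mu.

(** Functions on [0, 1] are represented by functions on the line of which only
    the values on [0, 1] are ever inspected. *)
Definition Linfty01 (R : realType) : set (R -> R) :=
  [set F : R -> R |
    measurable_fun (`[0, 1] : set (lebesgueR R)) (F : lebesgueR R -> R) /\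
    [bounded F x | x in `[0, 1]]].

Definition supnorm01 (R : realType) (F : R -> R) : R :=
  sup [set `|F x| | x in `[0, 1]].

Definition Omega (R : realType) (n : nat) (F : R -> R) (x : R) : R :=
  n%:R * x ^+ (n - 1) - (n%:R - 1) * x ^+ n
  - n%:R * x ^+ (n - 1)
    * \int[completed_lebesgue_measure]_(z in `[0, 1 - x]) F z.

(* Main.v *)
Require Import Defs.
From HB Require Import structures.
From mathcomp Require Import all_boot all_order all_algebra.
From mathcomp Require Import all_classical all_reals all_analysis.
From mathcomp Require Import measurable_realfun ring.
Import Order.TTheory GRing.Theory Num.Theory.
Import numFieldNormedType.Exports.
Local Open Scope classical_set_scope.
Local Open Scope ring_scope.

(* On [0, 1], Omega F1 x - Omega F2 x = - n x^(n-1) \int_0^(1-x) (F1 - F2) is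
   bounded by n x^(n-1) (1 - x) ||F1 - F2||, and the maximum of
   n x^(n-1) (1 - x) is ((n-1)/n)^(n-1), reached at x = (n-1)/n. *)

(** The left side equals 1 at [m = 0] and does not increase with [m]: passing from [m] to [m.+1]
    lowers it by t^m (m+1) (1-t)^2. *)
Lemma exprn_mul_affine_le1 (R : realDomainType) (m : nat) (t : R) : 0 <= t ->
  t ^+ m * (1 + m%:R * (1 - t)) <= 1.
Proof.
move=> t0; elim: m => [|m IH]; first by rewrite mul0r addr0 mulr1.
apply: le_trans IH; rewrite exprSr -mulrA ler_wpM2l ?exprn_ge0// -subr_ge0.
have -> : 1 + m%:R * (1 - t) - t * (1 + m.+1%:R * (1 - t)) =
          m.+1%:R * (1 - t) ^+ 2 by rewrite -natr1; ring.
by rewrite mulr_ge0// sqr_ge0.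
Qed.

Lemma exprn_mul_onem_le (R : realFieldType) (n : nat) (x : R) : (2 <= n)%N -> 0 <= x ->
  n%:R * x ^+ (n - 1) * (1 - x) <= ((n%:R - 1) / n%:R) ^+ (n - 1).
Proof.
case: n => [//|[//|m]] _ x0; rewrite subSS subn0 -[m.+2%:R]natr1 addrK.
(* The maximum is at [a]: in the variable [x / a] the bound becomes 1. *)
set k := m.+1; have k0 : (0 : R) < k%:R by rewrite ltr0n.
have k1 : k%:R + 1 != 0 :> R by rewrite natr1.
pose a : R := k%:R / (k%:R + 1); have a0 : 0 < a by rewrite divr_gt0// natr1.
have -> : (k%:R + 1) * x ^+ k * (1 - x) =
    a ^+ k * ((x / a) ^+ k * (1 + k%:R * (1 - x / a))).
  rewrite mulrA -exprMn (mulrC a) divfK ?gt_eqF// mulrAC mulrC; congr (_ * _).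
  (* As k / a = k + 1, the factor 1 + k (1 - x/a) is (k + 1) (1 - x). *)
  by rewrite /a; field; rewrite k1 gt_eqF.
by rewrite ler_piMr ?exprn_ge0 ?exprn_mul_affine_le1 ?divr_ge0// ltW.
Qed.

Lemma contraction_constant_lt1 (R : realFieldType) (n : nat) : (2 <= n)%N ->
  ((n%:R - 1) / n%:R) ^+ (n - 1) < 1 :> R.
Proof.
(* With n = m + 2 the exponent is m + 1 > 0; a zero exponent would give exactly 1. *)
case: n => [//|[//|m]] _; rewrite subSS subn0 -[m.+2%:R]natr1 addrK.
by rewrite exprn_ilt1 ?divr_ge0 ?natr1// ltr_pdivrMr// mul1r ltr_nat.
Qed.

Section completed_lebesgue.
Context {R : realType}.
Local Notation mu := (@completed_lebesgue_measure R).

Lemma measurable_lebesgueR (A : set R) :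
  measurable A -> measurable (A : set (lebesgueR R)).
Proof. exact: sub_caratheodory. Qed.

Lemma measurable_fun_lebesgueR (D : set R) (f : R -> R) : measurable D ->
  measurable_fun D f ->
  measurable_fun (D : set (lebesgueR R)) (f : lebesgueR R -> R).
Proof. by move=> mD mf _ Y mY; apply: measurable_lebesgueR; exact: mf. Qed.

Lemma completed_lebesgue_measure_cc (a b : R) : a <= b ->
  mu `[a, b] = (b - a)%:E.
Proof.
(* Both measures restrict the same outer measure, so they agree on a Borel set by conversion. *)
move=> ab; transitivity (lebesgue_measure (`[a, b] : set R)); first by [].
rewrite lebesgue_measure_itv/= lte_fin; case: ltgtP ab => // -> _.
by rewrite subrr.
Qed.

Lemma Linfty01_integrable {F : R -> R} {x : R} : x <= 1 -> Linfty01 F ->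
  mu.-integrable `[0, x] (EFin \o F).
Proof.
move=> x1 [mF bF].
apply: (@integrableS _ _ _ mu (`[0, 1] : set R)).
- exact: measurable_lebesgueR.
- exact: measurable_lebesgueR.
- by apply: subset_itvl; rewrite bnd_simp.
apply: measurable_bounded_integrable => //.
  exact: measurable_lebesgueR.
by rewrite [ltLHS](completed_lebesgue_measure_cc 0 1 ler01) ltry.
Qed.

Lemma Linfty01_cst (M : R) : Linfty01 (cst M).
Proof. by split; [exact: measurable_cst|exact: bounded_cst]. Qed.

Lemma Linfty01_bound (F : R -> R) : Linfty01 F ->
  exists M, forall x, 0 <= x <= 1 -> `|F x| <= M.
Proof.
move=> [_ /ex_strict_bound_gt0[M _ FM]]; exists M => x x01.
by apply/ltW/FM; rewrite /= in_itv.
Qed.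

(** Measurability is meant here in the Borel sense, which [Omega n F] satisfies on [0, 1] even when
    [F] is only Lebesgue measurable. *)
Lemma Linfty01_of_bound (F : R -> R) (M : R) :
  measurable_fun (`[0, 1] : set R) F ->
  (forall x, 0 <= x <= 1 -> `|F x| <= M) -> Linfty01 F.
Proof.
move=> mF FM; split; first exact: measurable_fun_lebesgueR.
exists M; split; first exact: num_real.
by move=> N MN x/=; rewrite in_itv/= => /FM /le_trans; apply; exact: ltW.
Qed.

Lemma normr_Rintegral_le (F : R -> R) (M x : R) : Linfty01 F -> 0 <= x <= 1 ->
  (forall z, 0 <= z <= 1 -> `|F z| <= M) ->
  `|\int[mu]_(z in `[0, x]) F z| <= M * x.
Proof.
move=> FL /andP[x0 x1] FM.
have mx := @measurable_lebesgueR _ (measurable_itv `[0, x]).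
have iF := Linfty01_integrable x1 FL.
apply: le_trans (le_normr_Rintegral mx iF) _.
have -> : M * x = \int[mu]_(z in `[0, x]) M.
  rewrite Rintegral_cst// [X in fine X](completed_lebesgue_measure_cc 0 x x0).
  by rewrite subr0.
apply: le_Rintegral => //.
- exact: integrable_norm.
- exact: Linfty01_integrable (Linfty01_cst M).
- by move=> z/=; rewrite in_itv/= => /andP[z0 zx]; rewrite FM// z0 (le_trans zx).
Qed.

(* Adding a constant makes the integrand nonnegative, so that the integral
   becomes monotone in its upper bound. *)
Lemma measurable_Rintegral_upper (F : R -> R) : Linfty01 F ->
  measurable_fun (`[0, 1] : set R)
    (fun x => \int[mu]_(z in `[0, 1 - x]) F z).
Proof.
move=> FL; have [M FM] := Linfty01_bound _ FL.
(* Cutting with [0, 1] keeps the domain where [F] is controlled even for x < 0, so [G] is monotone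
   on the whole line. *)
pose D (x : R) : set R := `[0, 1 - x] `&` `[0, 1].
pose G x := \int[mu]_(z in D x) (F z + M).
have mD x : measurable (D x : set (lebesgueR R)).
  by apply: measurable_lebesgueR; exact: measurableI.
have iG : mu.-integrable `[0, 1] (EFin \o (fun z => F z + M)).
  rewrite [X in mu.-integrable _ X](_ : _ = (EFin \o F) \+ (EFin \o cst M))%E//.
  apply: integrableD.
  - exact: measurable_lebesgueR.
  - exact: Linfty01_integrable.
  - exact: Linfty01_integrable (Linfty01_cst M).
have mono : {homo G : x y /~ y <= x}.
  move=> x y xy.
  have iDG u : mu.-integrable (D u) (EFin \o (fun z => F z + M)).
    apply: integrableS iG => //; last exact: subIsetr.
    exact: measurable_lebesgueR.
  apply: fine_le.
  - exact: integrable_fin_num.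
  - exact: integrable_fin_num.
  apply: ge0_subset_integral => //.
  - exact: measurable_int (iDG x).
  - move=> z [_] /=; rewrite in_itv/= => /FM; rewrite ler_norml => /andP[MF _].
    by rewrite lee_fin -lerBlDr sub0r.
  - apply: setSI; apply: subset_itvl; rewrite bnd_simp.
    by rewrite lerD2l lerN2.
(* Undo the shift: for x in [0, 1], [D x] is [0, 1 - x], over which the constant M integrates to M
   (1 - x). *)
apply: (eq_measurable_fun (fun x => G x - M * (1 - x))).
  move=> x; rewrite inE/= in_itv/= => /andP[x0 x1].
  have y1 : 1 - x <= 1 by rewrite gerBl.
  have y0 : 0 <= 1 - x by rewrite subr_ge0.
  rewrite /G /D (setIidl (B := `[0, 1])); last first.
    by apply: subset_itvl; rewrite bnd_simp.
  rewrite RintegralD//.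
  - rewrite Rintegral_cst; last exact: measurable_lebesgueR.
    rewrite [X in fine X](completed_lebesgue_measure_cc 0 (1 - x) y0).
    by rewrite subr0 addrK.
  - exact: measurable_lebesgueR.
  - exact: Linfty01_integrable.
  - exact: Linfty01_integrable (Linfty01_cst M).
apply: measurable_funB; first exact: nonincreasing_measurable.
by apply: measurable_funM => //; exact: measurable_funB.
Qed.

Lemma Omega_Linfty01 (n : nat) (F : R -> R) : Linfty01 F -> Linfty01 (Omega n F).
Proof.
move=> FL; have [M FM] := Linfty01_bound _ FL.
(* On [0, 1] powers of x are at most 1 and the integral is at most M in absolute value; n - 1 keeps
   its absolute value since it is negative for n = 0. *)
apply: (Linfty01_of_bound _ (n%:R + `|n%:R - 1| + n%:R * M)).
  apply: measurable_funB.
    by apply: measurable_funB; apply: measurable_funM => //; exact: exprn_measurable.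
  apply: measurable_funM; last exact: measurable_Rintegral_upper.
  by apply: measurable_funM => //; exact: exprn_measurable.
move=> x /andP[x0 x1].
have y01 : 0 <= 1 - x <= 1 by rewrite subr_ge0 x1 gerBl.
have xk k : `|x ^+ k| <= 1 by rewrite ger0_norm ?exprn_ge0// exprn_ile1.
have nx : `|n%:R * x ^+ (n - 1)| <= n%:R.
  by rewrite normrM normr_nat ler_piMr.
apply: le_trans (ler_normB _ _) _; apply: lerD.
  apply: le_trans (ler_normB _ _) _; apply: lerD => //.
  by rewrite normrM ler_piMr.
rewrite normrM ler_pM//.
have M0 : 0 <= M by rewrite (le_trans _ (FM 0 _))// lexx ler01.
apply: le_trans (normr_Rintegral_le _ _ _ FL y01 FM) _.
by rewrite ler_piMr//; case/andP: y01.
Qed.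

Lemma Linfty01B (F1 F2 : R -> R) :
  Linfty01 F1 -> Linfty01 F2 -> Linfty01 (F1 \- F2).
Proof.
move=> F1L F2L; have [M1 FM1] := Linfty01_bound _ F1L.
have [M2 FM2] := Linfty01_bound _ F2L.
(* The difference is only Lebesgue measurable, so [Linfty01_of_bound] does not apply. *)
split; first exact: measurable_funB F1L.1 F2L.1.
exists (M1 + M2); split; first exact: num_real.
move=> N MN x/=; rewrite in_itv/= => x01; apply: ltW; apply: le_lt_trans MN.
by apply: le_trans (ler_normB _ _) _; rewrite lerD ?FM1 ?FM2.
Qed.

(** Boundedness makes the [sup] genuine; on an unbounded set it is a default value that bounds
    nothing. *)
Lemma le_supnorm01 (F : R -> R) (x : R) : Linfty01 F -> 0 <= x <= 1 ->
  `|F x| <= supnorm01 F.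
Proof.
move=> /Linfty01_bound[M FM] x01; apply: ub_le_sup.
  by exists M => _ [z + <-]; rewrite /= in_itv/=; exact: FM.
by exists x => //=; rewrite in_itv.
Qed.

Lemma supnorm01_le (F : R -> R) (M : R) :
  (forall x, 0 <= x <= 1 -> `|F x| <= M) -> supnorm01 F <= M.
Proof.
move=> FM; apply: ge_sup.
  by exists `|F 0|, 0 => //=; rewrite in_itv/= lexx ler01.
by move=> _ [z + <-]; rewrite /= in_itv/=; exact: FM.
Qed.

(** The terms free of F cancel; the integrals combine by linearity, since 0 <= x keeps [0, 1 - x]
    inside [0, 1], where both functions are integrable. *)
Lemma OmegaB (n : nat) (F1 F2 : R -> R) (x : R) :
  Linfty01 F1 -> Linfty01 F2 -> 0 <= x ->
  Omega n F1 x - Omega n F2 x =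
  - (n%:R * x ^+ (n - 1) * \int[mu]_(z in `[0, 1 - x]) (F1 \- F2) z).
Proof.
move=> F1L F2L x0; have y1 : 1 - x <= 1 by rewrite gerBl.
rewrite RintegralB.
- by rewrite /Omega; ring.
- exact: measurable_lebesgueR.
- exact: Linfty01_integrable.
- exact: Linfty01_integrable.
Qed.

End completed_lebesgue.

Theorem theorem1 (R : realType) (n : nat) (hn : (2 <= n)%N) :
  (forall F : R -> R, Linfty01 F -> Linfty01 (Omega n F)) /\
  ((n%:R - 1) / n%:R) ^+ (n - 1) < 1 :> R /\
  (forall F1 F2 : R -> R, Linfty01 F1 -> Linfty01 F2 ->
    supnorm01 (Omega n F1 \- Omega n F2)
      <= ((n%:R - 1) / n%:R) ^+ (n - 1) * supnorm01 (F1 \- F2)).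
Proof.
split; first by move=> F; exact: Omega_Linfty01.
split; first exact: contraction_constant_lt1.
move=> F1 F2 F1L F2L; have FL := Linfty01B _ _ F1L F2L.
apply: supnorm01_le => x /andP[x0 x1].
have y01 : 0 <= 1 - x <= 1 by rewrite subr_ge0 x1 gerBl.
have nx0 : 0 <= n%:R * x ^+ (n - 1) by rewrite mulr_ge0// exprn_ge0.
have s0 : 0 <= supnorm01 (F1 \- F2).
  by apply: le_trans (le_supnorm01 _ x FL _); rewrite ?x0.
rewrite /= OmegaB// normrN normrM (ger0_norm nx0).
apply: le_trans (_ : n%:R * x ^+ (n - 1) * ((1 - x) * supnorm01 (F1 \- F2)) <= _).
  rewrite ler_wpM2l// [leRHS]mulrC; apply: normr_Rintegral_le => // z.
  exact: le_supnorm01.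
(* By [s0], the scalar bound on n x^(n-1) (1 - x) may be multiplied by the norm. *)
by rewrite mulrA ler_wpM2r// exprn_mul_onem_le.
Qed.
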